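(* Let $R$ be an irreducible root system of rank $m$ with set of positive roots $R_+$, simple roots $\alpha_1,\dots,\alpha_m$, and highest root $\tilde\alpha=\sum_{i=1}^m n_i\alpha_i$, and let $h = 1+\sum_{i=1}^m n_i$ (the Coxeter number). With $\chi_R$ and $\Phi_R$ as defined in the context, $$\Phi_R(t) = \frac{(n_1\cdots n_m)\,(m!)\, t^h}{(1-t)\prod_{i=1}^m (1-t^{n_i})}.$$
   Context: Let $n=|R|/2=|R_+|$ and let $S=[S_{ij}]$ be the $m\times n$ integer matrix whose columns are the coefficient vectors of the positive roots with respect to the simple roots, i.e. $R_+=\{\sum_{i=1}^m S_{ij}\alpha_i : j=1,\dots,n\}$ (columns in any order). For a positive integer $q$, let $\mathbb{Z}_q=\mathbb{Z}/q\mathbb{Z}$, $\mathbb{Z}_q^\times=\mathbb{Z}_q\setminus\{0\}$ (nonzero residues), and $\chi_R(q) = |\{\mathbf z\in\mathbb{Z}_q^m : \mathbf z S\in(\mathbb{Z}_q^\times)^n\}|$. The generating function is the formal power series $\Phi_R(t)=\sum_{q=1}^\infty \chi_R(q)\,t^q$. *)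

(* Defs.v *)
From HB Require Import structures.
From mathcomp Require Import all_boot all_order all_algebra.
From mathcomp Require Import finmap reals.

Set Implicit Arguments.
Unset Strict Implicit.
Unset Printing Implicit Defensive.

Import Order.TTheory GRing.Theory Num.Theory.

Local Open Scope fset_scope.
Local Open Scope ring_scope.

Section RootSystems.
Variables (R : realType) (V : vectType R) (dot : {dot V for idfun}).
Implicit Types (Rt : {fset V}) (a b : V).

(* The number <b, a^vee> = 2 (b, a) / (a, a). *)
Definition cartan b a : R := 2 * dot b a / dot a a.

Definition reflection a b : V := b - cartan b a *: a.

(* Crystallographic and reduced; V is the Euclidean space spanned by Rt. *)
Record root_system Rt : Prop := RootSystem {
  roots_span : <<enum_fset Rt>>%VS = fullv;
  roots_neq0 : 0 \notin Rt;
  roots_reduced : forall a (c : R), a \in Rt -> c *: a \in Rt -> c = 1 \/ c = -1;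
  roots_reflection : forall a b, a \in Rt -> b \in Rt -> reflection a b \in Rt;
  roots_integral : forall a b, a \in Rt -> b \in Rt -> cartan b a \is a Num.int
}.

Definition irreducible_roots Rt : Prop :=
  Rt != fset0 /\
  forall A B : {fset V}, Rt = A `|` B ->
    (forall a b, a \in A -> b \in B -> dot a b = 0) -> A = fset0 \/ B = fset0.

End RootSystems.

Section SimpleRoots.
Variables (R : realType) (V : vectType R) (Rt : {fset V}).
Variables (m : nat) (alpha : m.-tuple V).

Record simple_roots : Prop := SimpleRoots {
  simple_basis : basis_of fullv alpha;
  simple_in_roots : forall i, tnth alpha i \in Rt;
  simple_int : forall b i, b \in Rt -> coord alpha i b \is a Num.int;
  simple_sign : forall b, b \in Rt ->
    (forall i, 0 <= coord alpha i b) \/ (forall i, coord alpha i b <= 0)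
}.

Definition pos_roots : {fset V} :=
  [fset b in Rt | [forall i, 0 <= coord alpha i b]].

(* Given integrality of the coordinates, coord b <= coord theta says that
   theta - b is a sum of simple roots. *)
Definition highest_root (theta : V) : Prop :=
  theta \in Rt /\
  forall b, b \in Rt -> forall i, coord alpha i b <= coord alpha i theta.

(* The cardinality condition forces the columns to be pairwise distinct. *)
Definition root_matrix (n : nat) (S : 'M[int]_(m, n)) : Prop :=
  n = #|` pos_roots | /\
  pos_roots = [fset \sum_(i < m) (S i j)%:~R *: tnth alpha i | j in 'I_n].

End SimpleRoots.

(* Z/qZ is the additive group 'I_q, which for q = 1 is trivial ('Z_1 is not);
   the j-th entry of zS only uses its structure of Z-module. *)
Definition chi (m n : nat) (S : 'M[int]_(m, n)) (q : nat) : nat :=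
  if q is p.+1 then
    #|[set z : 'rV['I_p.+1]_m |
        [forall j : 'I_n, \sum_(i < m) (z 0 i) *~ S i j != 0]]|
  else 0%N.

Section FormalPowerSeries.
Variable K : fieldType.

(* The k-th coefficient of f : fps is f k. *)
Definition fps := nat -> K.
Implicit Types f g : fps.

Definition fps_of_poly (p : {poly K}) : fps := fun k => p`_k.

Definition fps_mul f g : fps :=
  fun k => \sum_(i < k.+1) f i * g (k - i)%N.

Fixpoint fps_inv_seq f (k : nat) : seq K :=
  if k is l.+1 then
    let s := fps_inv_seq f l in
    rcons s (- (f 0%N)^-1 * \sum_(i < l.+1) f (l.+1 - i)%N * s`_i)
  else [:: (f 0%N)^-1].

Definition fps_inv f : fps := fun k => (fps_inv_seq f k)`_k.

Definition fps_div f g : fps := fps_mul f (fps_inv g).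

Lemma size_fps_inv_seq f k : size (fps_inv_seq f k) = k.+1.
Proof. by elim: k => //= k IHk; rewrite size_rcons IHk. Qed.

Lemma nth_fps_inv_seq f k i :
  (i <= k)%N -> (fps_inv_seq f k)`_i = fps_inv f i.
Proof.
elim: k => [|k IHk]; first by rewrite leqn0 => /eqP->.
rewrite leq_eqVlt => /predU1P[-> //|lt_ik].
by rewrite /= nth_rcons size_fps_inv_seq lt_ik IHk.
Qed.

Lemma fps_invS f k :
  fps_inv f k.+1 =
    - (f 0%N)^-1 * \sum_(i < k.+1) f (k.+1 - i)%N * fps_inv f i.
Proof.
rewrite {1}/fps_inv /= nth_rcons size_fps_inv_seq ltnn eqxx; congr (_ * _).
by apply: eq_bigr => i _; rewrite nth_fps_inv_seq // -ltnS.
Qed.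

Lemma fps_mulV f :
  f 0%N != 0 -> fps_mul (fps_inv f) f =1 fps_of_poly 1.
Proof.
move=> f0 [|k]; rewrite /fps_mul /fps_of_poly coef1 big_ord_recr /= subnn.
  by rewrite big_ord0 add0r /fps_inv /= mulVf.
rewrite fps_invS mulNr mulrC mulrN mulVKf //.
by under eq_bigr do rewrite mulrC; rewrite subrr.
Qed.

End FormalPowerSeries.

Definition chi_series (m n : nat) (S : 'M[int]_(m, n)) : fps rat :=
  fun q => (chi S q)%:R.

(* Main.v *)
(** View [z] as a coweight. For fixed [q] the hyperplanes [(zS)_j = q k] cut the
coweight space into alcoves. The reflections in the simple roots and in the
hyperplane [theta = q] permute the alcoves and, as integral affine maps, preserve
the coweight lattice; they carry every alcove to the fundamental one
[z_i > 0, sum_i c_i z_i < q]. Hence every alcove contains the same number [N q] of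
lattice points, and [chi q = C * N q], where [C] counts the alcoves modulo [q] and
does not depend on [q]. Since [chi q ~ q^m] and
[N q ~ q^m / (m! c_1 ... c_m)], the constant is [m! c_1 ... c_m], and the
generating function of [N] is [t^h / ((1 - t) prod_i (1 - t^c_i))]. *)

Require Import Defs.
From HB Require Import structures.
From mathcomp Require Import all_boot all_order all_algebra.
From mathcomp Require Import finmap reals.
From mathcomp Require Import zify ring lra.

Set Implicit Arguments.
Unset Strict Implicit.
Unset Printing Implicit Defensive.

Import Order.TTheory GRing.Theory Num.Theory.

Local Open Scope fset_scope.
Local Open Scope ring_scope.

(** * Lattice points in a dilated simplex *)

Section SimplexCount.
Local Open Scope nat_scope.
Variables (m : nat) (c : 'I_m -> nat).
Hypothesis c_gt0 : forall i, 0 < c i.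

(** Lattice points of the open simplex dilated by [q = p.+1]: the strict bound [< q] becomes [<= p].
    Bounding the coordinates by [p] loses nothing, since every [c i] is positive. *)
Definition simplex p := [set f : {ffun 'I_m -> 'I_p.+1} |
  [forall i, 0 < f i] && (\sum_i c i * f i <= p)].

Definition residues p :=
  [set r : {ffun 'I_m -> 'I_p.+1} | [forall i, r i < c i]].

Lemma card_residues p : (forall i, c i <= p) -> #|residues p| = \prod_i c i.
Proof.
move=> c_le; transitivity #|family (fun i (x : 'I_p.+1) => x < c i)|.
  by apply: eq_card => r; rewrite !inE.
rewrite card_family foldrE big_map big_enum /=; apply: eq_bigr => i _.
transitivity (\sum_(x < p.+1 | x < c i) 1); first by rewrite sum1_card.
by rewrite -(big_ord_widen p.+1 (fun=> 1)) ?sum1_card ?card_ord // leqW.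
Qed.

Lemma le_c_sum i : c i <= \sum_i c i.
Proof. by rewrite (bigD1 i) //= leq_addr. Qed.

(* Euclidean division [t_i = c_i w_i + r_i] compares the weighted simplex with the
   standard one. *)
Lemma simplex_lower p : \sum_i c i <= p ->
  'C(m + (p - \sum_i c i), m) <= #|simplex p| * \prod_i c i.
Proof.
move=> c_le; set M := p - _.
have ci_le i : c i <= p := leq_trans (le_c_sum i) c_le.
rewrite -(card_residues ci_le) -cardsX -card_partial_ord_partitions.
pose F (t : m.-tuple 'I_M.+1) :
    {ffun 'I_m -> 'I_p.+1} * {ffun 'I_m -> 'I_p.+1} :=
  ([ffun i => inord (tnth t i %/ c i).+1], [ffun i => inord (tnth t i %% c i)]).
(* Shifting each quotient by one makes it positive and costs [\sum_i c i] in the weighted sum,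
   whence the choice of [M]. *)
have sumE (t : m.-tuple 'I_M.+1) : \sum_(x <- t) x <= M ->
    \sum_i c i * (tnth t i %/ c i).+1 <= p.
  rewrite big_tuple => tM; apply: (@leq_trans (\sum_i (tnth t i + c i))).
    by apply: leq_sum => i _; rewrite mulnS addnC leq_add2r mulnC leq_trunc_div.
  by rewrite big_split -(subnK c_le) leq_add2r.
have divP (t : m.-tuple 'I_M.+1) i : \sum_(x <- t) x <= M ->
    (tnth t i %/ c i).+1 < p.+1.
  move/sumE; rewrite (bigD1 i) //=; have := c_gt0 i; nia.
have modP (t : m.-tuple 'I_M.+1) i : tnth t i %% c i < p.+1.
  by rewrite ltnS; apply: leq_trans (ci_le i); rewrite ltnW // ltn_mod.
rewrite -(@card_in_imset _ _ F).
  apply: subset_leq_card; apply/subsetP => _ /imsetP[t /[!inE] tM ->] /=.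
  apply/andP; split; last first.
    by apply/forallP => i; rewrite ffunE inordK // ltn_mod.
  apply/andP; split; first by apply/forallP => i; rewrite ffunE inordK // divP.
  rewrite (eq_bigr (fun i => c i * (tnth t i %/ c i).+1)); first exact: sumE.
  by move=> i _; rewrite ffunE inordK ?divP.
move=> s t /[!inE] sM tM [/ffunP E1 /ffunP E2]; apply: eq_from_tnth => i.
apply: val_inj => /=.
rewrite (divn_eq (tnth s i) (c i)) (divn_eq (tnth t i) (c i)).
move/(congr1 val): (E1 i); move/(congr1 val): (E2 i).
by rewrite /= !ffunE !inordK ?divP ?modP // => -> [->].
Qed.

(** The map [(f, r) |-> c_i (f_i - 1) + r_i] is injective by uniqueness of Euclidean division. Its
    values sum to at most [p - m], because [r_i < c_i] leaves a gap of at least 1 at each [i]. *)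
Lemma simplex_upper p : #|simplex p| * \prod_i c i <= 'C(p, m).
Proof.
(* A point of the simplex gives [\sum_i c i <= p], hence [m <= p], so that [p - m] is not
   truncated. *)
have [->//|/card_gt0P[f0]] := posnP #|simplex p|.
rewrite inE => /andP[/forallP f0_gt0 f0_le].
have c_le : \sum_i c i <= p.
  by apply: leq_trans f0_le; apply: leq_sum => i _; rewrite leq_pmulr.
have m_le : m <= p.
  apply: leq_trans c_le; rewrite -[X in X <= _]card_ord -sum1_card.
  exact: leq_sum.
have ci_le i : c i <= p := leq_trans (le_c_sum i) c_le.
rewrite -(card_residues ci_le) -cardsX -[X in 'C(X, m)](subnKC m_le).
rewrite -card_partial_ord_partitions.
pose F (u : {ffun 'I_m -> 'I_p.+1} * {ffun 'I_m -> 'I_p.+1}) :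
    m.-tuple 'I_(p - m).+1 :=
  [tuple inord (c i * (u.1 i).-1 + u.2 i) | i < m].
have sumE u : u \in setX (simplex p) (residues p) ->
    \sum_i (c i * (u.1 i).-1 + u.2 i) <= p - m.
  rewrite !inE => /andP[/andP[/forallP f_gt0 f_le] /forallP r_lt].
  rewrite leq_subRL // -[X in X + _]card_ord -sum1_card -big_split /=.
  apply: leq_trans f_le; apply: leq_sum => i _.
  by rewrite -[X in _ <= _ * X](prednK (f_gt0 i)) mulnS addnCA addnC leq_add2r.
have FP u i : u \in setX (simplex p) (residues p) ->
    c i * (u.1 i).-1 + u.2 i < (p - m).+1.
  by move/sumE; rewrite (bigD1 i) //= ltnS; apply: leq_trans; exact: leq_addr.
rewrite -(@card_in_imset _ _ F).
  apply: subset_leq_card; apply/subsetP => _ /imsetP[u uP ->].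
  rewrite inE big_tuple.
  rewrite (eq_bigr (fun i => c i * (u.1 i).-1 + u.2 i)); first exact: sumE.
  by move=> i _; rewrite tnth_mktuple inordK ?FP.
move=> [f r] [g s] frP gsP E.
have {}E i : c i * (f i).-1 + r i = c i * (g i).-1 + s i.
  have := congr1 (fun t => val (tnth t i)) E.
  rewrite !tnth_mktuple /= !inordK //; [exact: (FP (g, s))|exact: (FP (f, r))].
move: frP gsP; rewrite !inE /= => /andP[/andP[/forallP f_gt0 _] /forallP r_lt].
move=> /andP[/andP[/forallP g_gt0 _] /forallP s_lt].
have E2 i : r i = s i :> nat.
  have := congr1 (modn^~ (c i)) (E i).
  by rewrite /= !(mulnC (c i)) !modnMDl !modn_small.
congr (_, _); apply/ffunP => i; apply: val_inj => /=; last exact: E2.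
have /eqP := E i; rewrite E2 eqn_add2r eqn_pmul2l // => /eqP.
by move=> E1; rewrite -(prednK (f_gt0 i)) -(prednK (g_gt0 i)) E1.
Qed.

Lemma ffact_le_expn k l : k ^_ l <= k ^ l.
Proof.
rewrite ffact_prod -[l in k ^ l]card_ord -prod_nat_const.
by apply: leq_prod => i _; exact: leq_subr.
Qed.

Lemma expn_le_ffact k l : k ^ l <= (l + k) ^_ l.
Proof.
rewrite ffact_prod -[l in k ^ l]card_ord -prod_nat_const.
by apply: leq_prod => i _; have := ltn_ord i; lia.
Qed.

Lemma simplex_ge p : \sum_i c i <= p ->
  (p - \sum_i c i) ^ m <= (\prod_i c i) * m`! * #|simplex p|.
Proof.
move=> c_le; apply: leq_trans (expn_le_ffact _ _) _; rewrite -bin_ffact.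
have := simplex_lower c_le; have := fact_gt0 m; nia.
Qed.

Lemma simplex_le p : (\prod_i c i) * m`! * #|simplex p| <= p ^ m.
Proof.
apply: leq_trans _ (ffact_le_expn _ _); rewrite -bin_ffact.
have := simplex_upper p; have := fact_gt0 m; nia.
Qed.

End SimplexCount.

(** * Limits of natural-number inequalities *)

Section Asymptotics.
Local Open Scope nat_scope.

(** Bernoulli's inequality [(1 - 1/(t+1))^m >= 1 - m/(t+1)] with denominators cleared; truncated
    subtraction makes the case [m > t + 1] trivial. *)
Lemma expn_bernoulli t m : t.+1 ^ m * (t.+1 - m) <= t ^ m * t.+1.
Proof.
elim: m => [|m IHm]; first by rewrite subn0.
have [lt|le] := leqP t.+1 m.+1.
  by have /eqP-> : t.+1 - m.+1 == 0; rewrite ?muln0.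
rewrite !expnS; set a := t.+1 ^ m in IHm *; set b := t ^ m in IHm *.
have {}IHm : t * (a * (t.+1 - m)) <= t * (b * t.+1).
  by rewrite leq_mul2l IHm orbT.
have -> : t * b * t.+1 = t * (b * t.+1) by rewrite mulnA.
apply: leq_trans IHm.
rewrite (mulnC t.+1) mulnCA -!mulnA leq_mul2l.
have [d dE] : exists d, t = m + d by exists (t - m); lia.
rewrite dE (_ : (m + d).+1 - m.+1 = d) 1?(_ : (m + d).+1 - m = d.+1); [|lia..].
by apply/orP; right; nia.
Qed.

(** [(t/(t+1))^m] tends to 1. In place of a limit the single value [t = a m] suffices: if [b < a],
    Bernoulli would give [t + 1 <= a m]. *)
Lemma leq_expn_limit m a b :
  (forall t, a * t ^ m <= b * t.+1 ^ m) -> a <= b.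
Proof.
move=> H; set t := a * m.
have t_gt0 : 0 < t.+1 ^ m by rewrite expn_gt0.
have : a * (t.+1 - m) <= b * t.+1.
  rewrite -(leq_pmul2l t_gt0) mulnCA.
  apply: leq_trans (leq_mul (leqnn _) (expn_bernoulli t m)) _.
  by rewrite mulnA (mulnCA _ b) mulnA leq_mul2r H orbT.
rewrite /t; nia.
Qed.

Lemma leq_linear_limit a b d : (forall p, a * p.+1 <= b * p.+1 + d) -> a <= b.
Proof. by move=> /(_ d); nia. Qed.

End Asymptotics.

(** * Generating function *)

Section GeneratingFunction.
Variables (K : fieldType) (m : nat) (c : 'I_m -> nat).
Hypotheses (c_gt0 : forall i, (0 < c i)%N) (sum_c_gt0 : (0 < \sum_i c i)%N).

Definition geom d B : {poly K} := \sum_(x < B.+1 | (0 < x)%N) 'X^(d * x).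

Lemma geom_mul d B : geom d B * (1 - 'X^d) = 'X^d * (1 - 'X^(d * B)).
Proof.
rewrite mulrBr mulr1 [in RHS]mulrBr mulr1 -exprD.
elim: B => [|B IHB].
  by rewrite /geom !big_mkcond !big_ord1 /= mul0r muln0 addn0 !subrr.
rewrite /geom big_mkcond big_ord_recr -big_mkcond /= -/(geom d B).
by rewrite mulrDl opprD addrACA IHB -exprD !mulnS !(addnC _ d) addrA subrK.
Qed.

Lemma coef_prod_geom p l : (\prod_i geom (c i) p)`_l =
  (#|[set f : {ffun 'I_m -> 'I_p.+1} |
     [forall i, 0 < f i]%N && (\sum_i c i * f i == l)%N]|)%:R.
Proof.
rewrite bigA_distr_big coef_sum /= -sum1_card natr_sum.
rewrite big_mkcond [in RHS]big_mkcond; apply: eq_bigr => f _.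
rewrite inE.
have -> : (f \in ffun_on (fun x : 'I_p.+1 => (0 < x)%N)) =
    [forall i, 0 < f i]%N by [].
case: ifP => //= _; rewrite -(big_morph _ (exprD 'X) (expr0 'X)) coefXn eq_sym.
by case: eqP.
Qed.

Lemma coef_geom1 B j : (geom 1 B)`_j = (0 < j <= B)%N%:R.
Proof.
rewrite coef_sum; under eq_bigr do rewrite mul1n coefXn.
have [j_le|j_gt] := leqP j B; last first.
  rewrite andbF big1 // => x _; case: eqP => // E.
  by have := ltn_ord x; rewrite -E; lia.
rewrite andbT big_mkcond (bigD1 (Ordinal (j_le : j < B.+1)%N)) //= eqxx.
rewrite big1 ?addr0 => [|x]; first by case: ltnP.
by rewrite -val_eqE /= eq_sym => /negPf->; rewrite if_same.
Qed.

(** The factor [geom 1 p.+1] supplies a positive slack variable, turning a fixed weighted sum into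
    the bound [<= p]; it accounts for the factor [1 - t] of the denominator. *)
Lemma coef_geom_simplex p :
  (geom 1 p.+1 * \prod_i geom (c i) p)`_p.+1 = #|simplex c p|%:R.
Proof.
rewrite coefM big_ord_recl /= coef_geom1 mul0r add0r.
rewrite (eq_bigr (fun l : 'I_p.+1 =>
    (\prod_i geom (c i) p)`_(p - l))); last first.
  by move=> l _; rewrite coef_geom1 /= /bump /= subSS ltn_ord mul1r.
rewrite (reindex_inj rev_ord_inj) /=.
under eq_bigr => l _ do rewrite subSS subKn ?coef_prod_geom 1?leq_ord //.
rewrite -natr_sum; congr _%:R.
pose tot (f : {ffun 'I_m -> 'I_p.+1}) : 'I_p.+1 := inord (\sum_i c i * f i)%N.
rewrite -sum1_card (partition_big tot xpredT) //=; apply: eq_bigr => l _.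
rewrite -sum1_card; apply: eq_bigl => f; rewrite !inE -val_eqE /= -andbA.
congr (_ && _); apply/eqP/andP => [E|[le /eqP]]; last by rewrite /tot inordK.
by rewrite /tot E leq_ord inord_val.
Qed.

Lemma fps_mul_poly (f : {poly K}) (g : fps K) k :
  fps_mul (fps_of_poly f) g k = (f * \poly_(i < k.+1) g i)`_k.
Proof.
by rewrite coefM; apply: eq_bigr => i _; rewrite coef_poly ltnS leq_subr.
Qed.

Lemma coef_mul_inv (P : {poly K}) k l : P`_0 != 0 -> (l <= k)%N ->
  ((\poly_(i < k.+1) fps_inv (fps_of_poly P) i) * P)`_l = (l == 0%N)%:R.
Proof.
move=> P0 le_lk; rewrite -coef1 -[RHS](fps_mulV P0) coefM.
apply: eq_bigr => i _; rewrite coef_poly ltnS.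
by rewrite (leq_trans _ le_lk) // -ltnS.
Qed.

Definition denom : {poly K} := (1 - 'X) * \prod_i (1 - 'X^(c i)).

Lemma denom0 : denom`_0 = 1.
Proof.
rewrite -horner_coef0 /denom hornerM horner_prod !hornerE subr0 mul1r.
rewrite big1 // => i _.
by rewrite !hornerE expr0n eqn0Ngt c_gt0 subr0.
Qed.

(** Multiplying out leaves the factors [1 - X^(p+1)] and [1 - X^(c_i p)], all congruent to 1 modulo
    [X^p]. As [\sum_i c i] is positive, the monomial in front raises the truncation error to order
    [p + 2]. *)
Lemma geom_denom p : exists r,
  geom 1 p.+1 * (\prod_i geom (c i) p) * denom =
  'X^((\sum_i c i).+1) + 'X^(p.+2) * r.
Proof.
have [s sE] : exists s : {poly K},
    (1 - 'X^(p.+1)) * \prod_i (1 - 'X^(c i * p)) = 1 + 'X^p * s.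
  have mulP (u v : {poly K}) : (exists s, u = 1 + 'X^p * s) ->
      (exists s, v = 1 + 'X^p * s) -> exists s, u * v = 1 + 'X^p * s.
    move=> [s ->] [t ->]; exists (s + t + 'X^p * s * t); ring.
  apply: (mulP); first by exists (- 'X); rewrite exprSr mulrN.
  apply: (big_ind (fun u : {poly K} => exists s, u = 1 + 'X^p * s))
    => [|u v|i _].
  - by exists 0; rewrite mulr0 addr0.
  - exact: mulP.
  exists (- 'X^(c i * p - p)); rewrite mulrN -exprD subnKC //.
  by rewrite leq_pmull.
have [d dE] : exists d, (\sum_i c i)%N = d.+1.
  by exists (\sum_i c i).-1; rewrite prednK.
exists ('X^d * s).
transitivity ('X^((\sum_i c i).+1) *
    ((1 - 'X^(p.+1)) * \prod_i (1 - 'X^(c i * p)) : {poly K})).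
  have := geom_mul 1 p.+1; rewrite expr1 mul1n => g1.
  rewrite /denom mulrACA g1 -big_split /=.
  rewrite (eq_bigr _ (fun i _ => geom_mul (c i) p)) big_split /=.
  by rewrite -(big_morph _ (exprD 'X) (expr0 'X)) mulrACA -exprS.
by rewrite sE mulrDr mulr1 dE !exprS; ring.
Qed.

Lemma fps_div_denom (a : K) k :
  fps_div (fps_of_poly (a *: 'X^((\sum_i c i).+1))) (fps_of_poly denom) k =
  if k is p.+1 then a * #|simplex c p|%:R else 0.
Proof.
rewrite /fps_div fps_mul_poly -scalerAl coefZ; set I := \poly_(i < _) _.
case: k @I => [|p] I; first by rewrite exprS -mulrA coefXM mulr0.
congr (_ * _); have [r rE] := geom_denom p.
(* The error term does not reach the coefficient [p + 1]; what remains is [denom] against its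
   truncated inverse, whose product is 1 up to that degree. *)
have -> : 'X^((\sum_i c i).+1) =
    geom 1 p.+1 * (\prod_i geom (c i) p) * denom - 'X^(p.+2) * r.
  by rewrite rE addrK.
rewrite mulrBl coefB -[_ * r * I]mulrA coefXnM ltnSn subr0 -coef_geom_simplex.
rewrite -[_ * denom * I]mulrA (mulrC denom).
move: (geom 1 p.+1 * _) => Q; rewrite coefM big_ord_recr /= subnn.
rewrite coef_mul_inv ?denom0 ?oner_neq0 //= mulr1 big1 ?add0r // => i _.
rewrite coef_mul_inv ?denom0 ?oner_neq0 ?leq_subr //.
by rewrite subn_eq0 leqNgt ltn_ord mulr0.
Qed.

End GeneratingFunction.

(** * Alcoves *)

Lemma slabE (q k x : int) : 0 < q ->
  (q * k < x < q * (k + 1)) = ~~ (q %| x)%Z && ((x %/ q)%Z == k).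
Proof.
move=> q_gt0; have q_neq0 : q != 0 by rewrite gt_eqF.
apply/andP/andP => [[lo hi]|[ndvd /eqP<-]].
  have E : (x %/ q)%Z = k.
    rewrite (_ : x = (k * q) + (x - k * q)); last by ring.
    by rewrite divzMDl // divz_small ?addr0 //; lia.
  split; last exact/eqP.
  apply/negP => /divzK xE; rewrite E in xE.
  by move: lo; rewrite -xE mulrC ltxx.
have := divz_eq x q; have := modz_ge0 x q_neq0; have := ltz_pmod x q_gt0.
move: ndvd; rewrite (sameP dvdz_mod0P eqP) => /eqP; lia.
Qed.

Section Alcoves.
Variables (m n : nat) (S : 'M[int]_(m, n)).
Implicit Types (z b : 'rV[int]_m) (k : 'I_n -> int) (q : nat).

(** [k] is the address of an alcove of the arrangement dilated by [q]; an arbitrary [k] may describe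
    an empty region. *)
Definition in_alcove q k z :=
  [forall j, q%:Z * k j < (z *m S) 0 j < q%:Z * (k j + 1)].

(* The hyperplane [(zS)_j0 = q e] admits the reflection
   [z |-> z - ((zS)_j0 - q e) b], with [b] the coroot of the [j0]-th root, and
   this reflection permutes the other families [(zS)_j in qZ], [p] being the
   induced permutation of the positive roots. *)
Definition wall (j0 : 'I_n) (e : int) := exists b (p : 'I_n -> 'I_n),
  [/\ (b *m S) 0 j0 = 2, injective p, p j0 = j0 &
   forall j : 'I_n, j != j0 ->
     (e * (b *m S) 0 j = 0 /\
        col j S - (b *m S) 0 j *: col j0 S = col (p j) S) \/
     (e * (b *m S) 0 j = 1 /\
        col j S - (b *m S) 0 j *: col j0 S = - col (p j) S)].

Lemma mulmx_col z j : (z *m S) 0 j = (z *m col j S) 0 0.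
Proof. by rewrite !mxE; apply: eq_bigr => i _; rewrite mxE. Qed.

Lemma eq_in_alcove q k1 k2 z : k1 =1 k2 -> in_alcove q k1 z = in_alcove q k2 z.
Proof. by move=> E; apply: eq_forallb => j; rewrite E. Qed.

Lemma wall_reflect j0 e k : wall j0 e -> exists k',
  (\sum_j `|k' j| + `|k j0| = \sum_j `|k j| + `|(2 * e - 1 - k j0)%R|)%N /\
  forall q, exists f, involutive f /\
    forall z, in_alcove q k z = in_alcove q k' (f z).
Proof.
move=> [b [p [bj0 p_inj pj0 pP]]].
(* On the [j0]-th family the reflection is [x |-> 2 q e - x], whence [2 e - 1 - k j0]. Where the
   sign flips, the shift by [q] turns [- k - 1] into [- k], so the other absolute values are merely
   permuted. *)
exists (fun j : 'I_n => if j == j0 then 2 * e - 1 - k j0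
         else if e * (b *m S) 0 j == 0 then k (p j) else - k (p j)).
split.
  rewrite [in RHS](reindex_inj p_inj) [in LHS](bigD1 j0) //= eqxx.
  rewrite [in RHS](bigD1 j0) //=.
  rewrite pj0 (eq_bigr (fun j => `|k (p j)|%N)); first by lia.
  by move=> j /negPf->; case: ifP => // _; rewrite abszN.
move=> q; exists (fun z => z - ((z *m S) 0 j0 - q%:Z * e) *: b).
have fS z j : ((z - ((z *m S) 0 j0 - q%:Z * e) *: b) *m S) 0 j =
    (z *m S) 0 j - ((z *m S) 0 j0 - q%:Z * e) * (b *m S) 0 j.
  by rewrite mulmxBl -scalemxAl !mxE.
split=> [z|z].
  rewrite fS bj0 -addrA -opprD -scalerDl.
  by rewrite [X in X *: b](_ : _ = 0) ?scale0r ?subr0 //; ring.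
pose P j := q%:Z * k j < (z *m S) 0 j < q%:Z * (k j + 1).
have -> : in_alcove q k z = [forall j, P (p j)].
  apply/forallP/forallP => H j; first exact: H.
  by have [p' _ p'K] := injF_bij p_inj; rewrite -[j]p'K; apply: H.
apply: eq_forallb => j; rewrite fS /P.
have [->|j_j0] := eqVneq j j0; first by rewrite pj0 bj0; lia.
have colE : (z *m S) 0 j - (b *m S) 0 j * (z *m S) 0 j0 =
   (z *m (col j S - (b *m S) 0 j *: col j0 S)) 0 0.
  rewrite mulmxBr -scalemxAr !(mulmx_col z) [in RHS]mxE; congr (_ + _).
  by rewrite [in RHS]mxE [in RHS]mxE.
rewrite (_ : _ - _ * _ = (z *m S) 0 j - (b *m S) 0 j * (z *m S) 0 j0 +
  q%:Z * (e * (b *m S) 0 j)); last by ring.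
have [] := pP j j_j0 => -[-> cE]; rewrite colE cE.
  by rewrite eqxx -mulmx_col; lia.
rewrite mulmxN [in RHS]mxE oner_eq0 -mulmx_col; lia.
Qed.

(** * Reduction to the fundamental alcove *)

Section FundamentalAlcove.
Variables (c : 'I_m -> nat) (sg : 'I_m -> 'I_n) (jt : 'I_n).
Hypothesis S_ge0 : forall i j, 0 <= S i j.
Hypothesis S_col : forall j, exists i, 0 < S i j.
Hypothesis S_le : forall i j, S i j <= (c i)%:Z.
Hypothesis S_jt : forall i, S i jt = (c i)%:Z.
Hypothesis S_sg : forall i l, S l (sg i) = (l == i)%:R.
Hypotheses (wall_sg : forall i, wall (sg i) 0) (wall_jt : wall jt 1).

Lemma mulmx_sg z i : (z *m S) 0 (sg i) = z 0 i.
Proof.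
rewrite mxE (bigD1 i) //= S_sg eqxx mulr1 big1 ?addr0 // => l /negPf ll.
by rewrite S_sg ll mulr0.
Qed.

(* A wall separating an alcove from the fundamental one yields a reflection that
   lowers [\sum_j |k j|]; the reflections used do not depend on the dilation. *)
Lemma alcove_transport k q0 z0 : (0 < q0)%N -> in_alcove q0 k z0 ->
  forall q, exists f g, [/\ cancel f g, cancel g f &
    forall z, in_alcove q k z = in_alcove q (fun=> 0) (f z)].
Proof.
move=> q0_gt0; have [d] := ubnP (\sum_j `|k j|)%N.
elim: d k z0 => // d IHd k z0 led kz0 q.
have step j0 e : wall j0 e -> (`|(2 * e - 1 - k j0)%R| < `|k j0|)%N ->
    exists f g, [/\ cancel f g, cancel g f &
    forall z, in_alcove q k z = in_alcove q (fun=> 0) (f z)].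
  move=> W lt; have [k' [Dk' H]] := wall_reflect k W.
  have [f0 [_ f0P]] := H q0.
  have [||f [g [fK gK fP]]] := IHd k' (f0 z0) _ _ q; first by lia.
    by rewrite -f0P.
  have [r [rK rP]] := H q.
  exists (f \o r), (r \o g); split=> [z|z|z] /=; first by rewrite fK rK.
    by rewrite rK gK.
  by rewrite rP fP.
(* With [e = 0] the new entry is [- 1 - k], smaller in absolute value exactly when [k < 0]; with
   [e = 1] it is [1 - k], smaller exactly when [k > 0]. *)
have [/existsP[i ki]|k_ge0] := boolP [exists i, k (sg i) < 0].
  by apply: step (wall_sg i) _; lia.
have {}k_ge0 i : 0 <= k (sg i).
  by rewrite leNgt; apply: contraNN k_ge0 => ?; apply/existsP; exists i.
have [kt|kt] := ltP 0 (k jt); first by apply: step wall_jt _; lia.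
(* No wall separates any more: [z0] has nonnegative coordinates and the column [jt] dominates the
   others, so [0 <= (z0 S)_j < q0] for all [j] and the address is zero. *)
exists id, id; split=> // z; apply: eq_in_alcove => j.
have kP j' := forallP kz0 j'.
have z_ge0 i : 0 <= z0 0 i.
  by have := kP (sg i); rewrite mulmx_sg; have := k_ge0 i; nia.
have zj : 0 <= (z0 *m S) 0 j.
  by rewrite mxE sumr_ge0 // => i _; rewrite mulr_ge0.
have zjt : (z0 *m S) 0 j <= (z0 *m S) 0 jt.
  by rewrite !mxE ler_sum // => i _; rewrite ler_wpM2l // S_jt.
have := kP j; have := kP jt; nia.
Qed.

Lemma in_alcove0E q z :
  in_alcove q (fun=> 0) z =
  [forall i, 0 < z 0 i] && (\sum_i (c i)%:Z * z 0 i < q%:Z).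
Proof.
have tE : \sum_i (c i)%:Z * z 0 i = (z *m S) 0 jt.
  by rewrite mxE; apply: eq_bigr => i _; rewrite S_jt mulrC.
rewrite tE; apply/forallP/andP => [H|[/forallP z_gt0 lt j]].
  split; last by have := H jt; lia.
  by apply/forallP => i; have := H (sg i); rewrite mulmx_sg; lia.
have z_ge0 i := ltW (z_gt0 i).
have [i Sij] := S_col j.
have : 0 < (z *m S) 0 j.
  rewrite mxE (bigD1 i) //= ltr_pwDl ?mulr_gt0 //.
  by rewrite sumr_ge0 // => l _; rewrite mulr_ge0.
have : (z *m S) 0 j <= (z *m S) 0 jt.
  by rewrite !mxE ler_sum // => l _; rewrite ler_wpM2l // S_jt.
lia.
Qed.

(** * Counting residues alcove by alcove *)

Definition lift_row p (z : 'rV['I_p.+1]_m) : 'rV[int]_m :=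
  map_mx (fun x : 'I_p.+1 => x%:Z) z.

Definition alcove_card p k :=
  #|[set z : 'rV['I_p.+1]_m | in_alcove p.+1 k (lift_row z)]|.

(** [alcove_card] only sees the box [0 <= z_i < q]. The condition on [k'] at the simple columns puts
    the target alcove inside this box, so all images under [f] are counted. *)
Lemma alcove_card_le p k k' f : injective f ->
  (forall z, in_alcove p.+1 k z -> in_alcove p.+1 k' (f z)) ->
  (forall i, k' (sg i) = 0) -> (alcove_card p k <= alcove_card p k')%N.
Proof.
move=> f_inj fP k'0.
pose unlift (w : 'rV[int]_m) : 'rV['I_p.+1]_m :=
  map_mx (fun x : int => inord `|x|%N) w.
have unliftK w : in_alcove p.+1 k' w -> lift_row (unlift w) = w.
  move=> /forallP wP; apply/rowP => i; rewrite !mxE.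
  have := wP (sg i); rewrite mulmx_sg k'0 => wi.
  by rewrite inordK; lia.
have lift_inj : injective (@lift_row p).
  move=> x y /rowP E; apply/rowP => i; have := E i; rewrite !mxE => -[].
  exact: val_inj.
pose F (z : 'rV['I_p.+1]_m) := unlift (f (lift_row z)).
rewrite /alcove_card -(@card_in_imset _ _ F).
  apply: subset_leq_card; apply/subsetP => _ /imsetP[z /[!inE] kz ->].
  by rewrite /F unliftK fP.
move=> x y /[!inE] kx ky; rewrite /F => E; apply/lift_inj/f_inj.
by rewrite -(unliftK _ (fP _ kx)) E unliftK ?fP.
Qed.

Lemma alcove_card_eq p k : (forall i, k (sg i) = 0) ->
  (exists q0 z0, (0 < q0)%N && in_alcove q0 k z0) ->
  alcove_card p k = alcove_card p (fun=> 0).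
Proof.
move=> k0 [q0 [z0 /andP[q0_gt0 kz0]]].
have [f [g [fK gK fP]]] := alcove_transport q0_gt0 kz0 p.+1.
apply/eqP; rewrite eqn_leq; apply/andP; split.
  by apply: alcove_card_le (can_inj fK) _ _ => // z; rewrite fP.
by apply: alcove_card_le (can_inj gK) _ _ => // z; rewrite fP gK.
Qed.

(** If the alcove meets the box for [p] or for [p'], its simple entries vanish and both of its
    counts equal those of the fundamental alcove; otherwise both counts are zero. *)
Lemma alcove_card_prop p p' k :
  (alcove_card p k * alcove_card p' (fun=> 0) =
   alcove_card p' k * alcove_card p (fun=> 0))%N.
Proof.
have H r : (0 < alcove_card r k)%N -> (forall i, k (sg i) = 0) /\
    (exists q0 z0, (0 < q0)%N && in_alcove q0 k z0).
  case/card_gt0P => z /[!inE] kz.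
  split=> [i|]; last by exists r.+1, (lift_row z).
  have /forallP/(_ (sg i)) := kz; rewrite mulmx_sg mxE.
  rewrite slabE // => /andP[_ /eqP<-]; apply: divz_small.
  by rewrite absz_nat lez_nat ltz_nat ltn_ord.
have [[k0 kz]|] : ((forall i, k (sg i) = 0) /\
    (exists q0 z0, (0 < q0)%N && in_alcove q0 k z0)) \/
    (alcove_card p k = 0 /\ alcove_card p' k = 0)%N.
- have [kp|/H] := posnP (alcove_card p k); last by left.
  by have [kp'|/H] := posnP (alcove_card p' k); [right|left].
- rewrite [alcove_card p k]alcove_card_eq // [alcove_card p' k]alcove_card_eq //.
  exact: mulnC.
by move=> [-> ->].
Qed.

Lemma lift_row_ge0 p (z : 'rV['I_p.+1]_m) j : 0 <= (lift_row z *m S) 0 j.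
Proof. by rewrite mxE sumr_ge0 // => i _; rewrite mxE mulr_ge0. Qed.

Lemma lift_row_lt p (z : 'rV['I_p.+1]_m) j :
  (lift_row z *m S) 0 j < p.+1%:Z * (\sum_i c i).+1%:Z.
Proof.
apply: (@le_lt_trans _ _ (p.+1%:Z * (\sum_i c i)%:Z)); last by lia.
rewrite mxE (big_morph Posz PoszD (erefl (Posz 0))) mulr_sumr.
rewrite ler_sum // => i _; rewrite mxE.
by apply: ler_pM => //; rewrite lez_nat ltnW.
Qed.

Lemma lift_row_divz p (z : 'rV['I_p.+1]_m) j :
  let d := (((lift_row z *m S) 0 j)%R %/ p.+1%:Z)%Z in
  0 <= d /\ (`|d| < (\sum_i c i).+1)%N.
Proof.
have := lift_row_ge0 z j; have := lift_row_lt z j.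
move: ((lift_row z *m S) 0 j) => x x_lt x_ge0 d.
have d_ge0 : 0 <= d by rewrite divz_ge0.
by split=> //; rewrite -ltz_nat gez0_abs // ltz_divLR // mulrC.
Qed.

Lemma chi_dvd p : chi S p.+1 =
  #|[set z : 'rV['I_p.+1]_m |
      [forall j, ~~ (p.+1%:Z %| ((lift_row z *m S) 0 j)%R)%Z]]|.
Proof.
apply: eq_card => z; rewrite !inE; apply: eq_forallb => j; congr negb.
have -> : \sum_i z 0 i *~ S i j = inZp (\sum_i z 0%R i * `|S i j|)%N.
  rewrite (big_morph inZp (id1 := 0) (op1 := +%R)); last 2 first.
  - by move=> x y; apply: val_inj; rewrite /= modnDm.
  - exact: val_inj.
  apply: eq_bigr => i _; rewrite -{1}[S i j]gez0_abs // -pmulrn.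
  by rewrite Zp_mulrn.
have -> : (lift_row z *m S) 0 j = (\sum_i z 0%R i * `|S i j|)%N%:Z.
  rewrite mxE (big_morph Posz PoszD (erefl (Posz 0))).
  apply: eq_bigr => i _; rewrite mxE.
  by rewrite PoszM gez0_abs.
by rewrite dvdzE /= /dvdn -val_eqE.
Qed.

(** Points are sorted by the quotients of [(zS)_j] by [q]. The range of addresses does not depend on
    [p], so the sums for two dilations can be compared term by term. *)
Lemma chi_alcoves p : chi S p.+1 =
  (\sum_(k : {ffun 'I_n -> 'I_(\sum_i c i).+1})
     alcove_card p (fun j => (k j)%:Z))%N.
Proof.
pose typ (z : 'rV['I_p.+1]_m) : {ffun 'I_n -> 'I_(\sum_i c i).+1} :=
  [ffun j => inord `|(((lift_row z *m S) 0 j)%R %/ p.+1%:Z)%Z|%N].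
rewrite chi_dvd -sum1_card (partition_big typ xpredT) //=.
apply: eq_bigr => k _; rewrite /alcove_card -sum1_card; apply: eq_bigl => z.
have typE j : (typ z j)%:Z = (((lift_row z *m S) 0 j)%R %/ p.+1%:Z)%Z.
  by have [d_ge0 d_lt] := lift_row_divz z j; rewrite ffunE inordK // gez0_abs.
rewrite !inE; apply/andP/forallP => [[/forallP ndvd /eqP<- j]|H].
  by rewrite slabE // ndvd typE /=.
split; first by apply/forallP => j; have := H j; rewrite slabE // => /andP[].
apply/eqP/ffunP => j; apply: val_inj; apply/eqP; rewrite -eqz_nat typE.
by have := H j; rewrite slabE // => /andP[].
Qed.

(** Cross-multiplication avoids counting the alcoves: proportionality holds at each address, hence
    for the sum. *)
Lemma chi_prop p p' :
  (chi S p.+1 * alcove_card p' (fun=> 0) =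
   chi S p'.+1 * alcove_card p (fun=> 0))%N.
Proof.
rewrite !chi_alcoves !big_distrl /=; apply: eq_bigr => k _.
exact: alcove_card_prop.
Qed.

(** * Growth of [chi] and the value of the constant *)

Lemma chi_le p : (chi S p.+1 <= p.+1 ^ m)%N.
Proof. by apply: leq_trans (max_card _) _; rewrite card_mx card_ord mul1n. Qed.

(* On a slice [(zS)_j = q t] the coordinate of [z] at some [i] with [S i j > 0]
   is determined by the others, and only [h] values of [t] occur. *)
Lemma card_dvd_le p j :
  (p.+1 * #|[set z : 'rV['I_p.+1]_m | (p.+1%:Z %| ((lift_row z *m S) 0 j)%R)%Z]|
   <= (\sum_i c i).+1 * p.+1 ^ m)%N.
Proof.
set B := [set z | _]; have [i Sij] := S_col j.
(* Coordinate [i] is shifted by the second component and the quotient is recorded. The other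
   coordinates and the quotient determine the original [i]-th coordinate, and then the shift. *)
pose F (u : 'rV['I_p.+1]_m * 'I_p.+1) :
    'rV['I_p.+1]_m * 'I_(\sum_i c i).+1 :=
  (\row_l (if l == i then u.1 0 l + u.2 else u.1 0 l),
   inord `|(((lift_row u.1 *m S) 0 j)%R %/ p.+1%:Z)%Z|).
suff F_inj : {in setX B [set: 'I_p.+1] &, injective F}.
  have := card_in_imset F_inj; rewrite cardsX cardsT card_ord mulnC => <-.
  apply: leq_trans (max_card _) _.
  by rewrite card_prod card_mx !card_ord mul1n mulnC.
move=> [x s] [y t]; rewrite !inE /= !andbT => xB yB [/rowP rE qE].
have [dx_ge0 dx_lt] := lift_row_divz x j; have [dy_ge0 dy_lt] := lift_row_divz y j.
move/(congr1 val): qE; rewrite /= !inordK // => qE.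
have {}qE : (lift_row x *m S) 0 j = (lift_row y *m S) 0 j.
  rewrite -(divzK xB) -(divzK yB); congr (_ * _).
  by rewrite -[LHS]gez0_abs // qE gez0_abs.
have xy l : l != i -> x 0 l = y 0 l.
  by move=> /negPf li; have := rE l; rewrite !mxE li.
have xyi : x 0 i = y 0 i.
  move: qE; rewrite !mxE (bigD1 i) //= [in RHS](bigD1 i) //=.
  rewrite [in RHS](eq_bigr (fun l => lift_row x 0 l * S l j)); last first.
    by move=> l /xy xl; rewrite !mxE xl.
  move/addIr/mulIf; rewrite gt_eqF // => /(_ isT); rewrite !mxE => -[].
  exact: val_inj.
have xyE : x = y by apply/rowP => l; have [->|/xy] := eqVneq l i.
by have := rE i; rewrite !mxE eqxx xyE => /addrI ->.
Qed.

(** Union bound over the [n] divisibility conditions, each met by [O(q^(m-1))] points; the extra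
    factor [q] avoids the exponent [m - 1]. *)
Lemma chi_ge p :
  (p.+1 * p.+1 ^ m <= p.+1 * chi S p.+1 + n * ((\sum_i c i).+1 * p.+1 ^ m))%N.
Proof.
rewrite chi_dvd; set G := [set z | _].
have <- : #|{: 'rV['I_p.+1]_m}| = (p.+1 ^ m)%N.
  by rewrite card_mx card_ord mul1n.
rewrite -(cardsC G) mulnDr leq_add2l.
pose B j := [set z : 'rV['I_p.+1]_m | (p.+1%:Z %| ((lift_row z *m S) 0 j)%R)%Z].
have GB : ~: G \subset \bigcup_j B j.
  apply/subsetP => z; rewrite !inE negb_forall => /existsP[j /negbNE zj].
  by apply/bigcupP; exists j; rewrite ?inE.
apply: leq_trans (leq_mul (leqnn _) (subset_leq_card GB)) _.
apply: (@leq_trans (p.+1 * \sum_j #|B j|)%N).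
  rewrite leq_mul2l /=; elim/big_rec2: _ => [|j A a _ IH].
    by rewrite cards0.
  by apply: leq_trans (leq_card_setU _ _) _; rewrite leq_add2l.
rewrite big_distrr /=.
apply: leq_trans (leq_sum _ (fun j _ => card_dvd_le p j)) _.
by rewrite sum_nat_const card_ord cardsC card_mx card_ord mul1n.
Qed.

Lemma coef_highest_gt0 i : (0 < c i)%N.
Proof. by rewrite -ltz_nat (lt_le_trans _ (S_le i (sg i))) // S_sg eqxx. Qed.

Lemma alcove_card_simplex p : alcove_card p (fun=> 0) = #|simplex c p|.
Proof.
pose row_of (f : {ffun 'I_m -> 'I_p.+1}) : 'rV['I_p.+1]_m := \row_i f i.
have row_inj : injective row_of.
  by move=> f g /rowP E; apply/ffunP => i; have := E i; rewrite !mxE.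
have liftE (z : 'rV['I_p.+1]_m) :
    in_alcove p.+1 (fun=> 0) (lift_row z) = ([ffun i => z 0 i] \in simplex c p).
  rewrite in_alcove0E inE; congr (_ && _).
    by apply: eq_forallb => i; rewrite mxE ffunE ltz_nat.
  rewrite -ltnS -ltz_nat (big_morph Posz PoszD (erefl (Posz 0))); congr (_ < _).
  by apply: eq_bigr => i _; rewrite mxE ffunE PoszM.
rewrite -(card_imset _ row_inj); apply: eq_card => z; rewrite inE liftE.
apply/idP/imsetP => [zP|[f fP ->]].
  by exists [ffun i => z 0 i] => //; apply/rowP => i; rewrite mxE ffunE.
by rewrite (_ : [ffun _ => _] = f) //; apply/ffunP => i; rewrite ffunE mxE.
Qed.

Lemma chi_simplex p : chi S p.+1 = ((\prod_i c i) * m`! * #|simplex c p|)%N.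
Proof.
(* The reference count [K'] is taken at [p = h], where [simplex_ge] gives [1 <= A * K']; at
   [p = \sum_i c i] its lower bound would be [0 ^ m]. *)
pose h := (\sum_i c i).+1; pose A := ((\prod_i c i) * m`!)%N.
pose K := chi S h.+1; pose K' := #|simplex c h|.
have prop r : (chi S r.+1 * K' = K * #|simplex c r|)%N.
  by rewrite /K' -!alcove_card_simplex chi_prop.
have K'_gt0 : (0 < K')%N.
  have := simplex_ge coef_highest_gt0 (leqnSn (\sum_i c i)%N).
  by rewrite -/h subSnn exp1n -/K'; case: (K') => //; rewrite muln0.
suff KE : K = (A * K')%N.
  apply/eqP; rewrite -(eqn_pmul2r K'_gt0) prop KE -/A.
  by apply/eqP; rewrite -!mulnA (mulnC K').
apply/eqP; rewrite eqn_leq; apply/andP; split.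
  (* [r] is chosen so that [r - \sum_i c i = h * t] and [r + 1 = h * (t + 1)]; [simplex_ge] and
     [chi_le] then compare [t ^ m] with [t.+1 ^ m] after cancelling [h ^ m]. *)
  apply: (@leq_expn_limit m) => t; pose r := (\sum_i c i + h * t)%N.
  have h_gt0 : (0 < h ^ m)%N by rewrite expn_gt0.
  rewrite -(leq_pmul2l h_gt0) [leqLHS]mulnCA [leqRHS]mulnCA -!expnMn.
  have rE : (h * t.+1 = r.+1)%N by rewrite mulnS /r /h addSn.
  have := simplex_ge coef_highest_gt0 (leq_addr (h * t)%N (\sum_i c i)%N).
  rewrite -/A -/r /r addKn -/r rE => geL.
  apply: (@leq_trans (K * (A * #|simplex c r|))%N).
    by rewrite leq_mul2l geL orbT.
  by rewrite mulnCA -prop -mulnA leq_mul2l mulnC leq_mul2l chi_le !orbT.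
(* The reverse bound comes from [chi_ge] and [simplex_le]; the constant is the contribution of the
   points on the hyperplanes. *)
apply: (@leq_linear_limit _ _ (A * K' * (n * h))%N) => r.
have q_gt0 : (0 < r.+1 ^ m)%N by rewrite expn_gt0.
rewrite -(leq_pmul2r q_gt0) mulnDl -!(mulnA (A * K')%N).
apply: leq_trans (leq_mul (leqnn _) (chi_ge r)) _.
rewrite -/h mulnDr; apply: leq_add; last by rewrite -!mulnA.
have -> : (A * K' * (r.+1 * chi S r.+1) = K * r.+1 * (A * #|simplex c r|))%N.
  by transitivity (A * r.+1 * (chi S r.+1 * K'))%N; [ring | rewrite prop; ring].
rewrite leq_mul2l; apply/orP; right.
apply: leq_trans (simplex_le coef_highest_gt0 r) _.
by case: (m) => // m'; rewrite leq_exp2r.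
Qed.

End FundamentalAlcove.
End Alcoves.

(** * Root systems *)

Section RootWalls.
Variables (R : realType) (V : vectType R) (dot : {dot V for idfun}).
Variables (Rt : {fset V}) (m : nat) (alpha : m.-tuple V).
Variables (theta : V) (c : 'I_m -> nat) (n : nat) (S : 'M[int]_(m, n)).
Hypotheses (rtP : root_system dot Rt) (simP : simple_roots Rt alpha).
Hypotheses (highP : highest_root Rt alpha theta).
Hypothesis thetaE : theta = \sum_(i < m) (c i)%:R *: tnth alpha i.
Hypothesis matP : root_matrix Rt alpha S.

Let beta j : V := \sum_(i < m) (S i j)%:~R *: tnth alpha i.

Lemma coord_comb (k : 'I_m -> R) i :
  coord alpha i (\sum_l k l *: tnth alpha l) = k i.
Proof.
under eq_bigr do rewrite (tnth_nth 0).
by rewrite coord_sum_free // (basis_free (simple_basis simP)).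
Qed.

Lemma coord_inj v w : (forall i, coord alpha i v = coord alpha i w) -> v = w.
Proof.
have basisP := simple_basis simP.
move=> E; rewrite (coord_basis basisP (memvf v)) (coord_basis basisP (memvf w)).
by apply: eq_bigr => i _; rewrite E.
Qed.

Lemma coord_beta i j : coord alpha i (beta j) = (S i j)%:~R.
Proof. exact: coord_comb. Qed.

Lemma coord_theta i : coord alpha i theta = (c i)%:R.
Proof. by rewrite thetaE coord_comb. Qed.

Lemma coord_alpha i l : coord alpha l (tnth alpha i) = (l == i)%:R.
Proof.
by rewrite (tnth_nth 0) coord_free ?(basis_free (simple_basis simP)) // eq_sym.
Qed.

Lemma pos_rootsP b : reflect (b \in Rt /\ forall i, 0 <= coord alpha i b)
  (b \in pos_roots Rt alpha).
Proof.
rewrite !inE /=; apply: (iffP andP) => -[bR b_ge0]; split=> //; exact/forallP.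
Qed.

Lemma beta_pos j : beta j \in pos_roots Rt alpha.
Proof. by case: matP => _ ->; rewrite in_imfset. Qed.

Lemma beta_root j : beta j \in Rt.
Proof. by have /pos_rootsP[] := beta_pos j. Qed.

Lemma pos_beta b : b \in Rt -> (forall i, 0 <= coord alpha i b) ->
  exists j, beta j = b.
Proof.
move=> bR b_ge0; have : b \in pos_roots Rt alpha by apply/pos_rootsP.
by case: matP => _ -> /imfsetP[j _ ->]; exists j.
Qed.

(** The [n] columns cover a set of [n] roots, so none repeats. *)
Lemma beta_inj : injective beta.
Proof.
apply/injectiveP; apply: (@leq_size_uniq _ (enum_fset (pos_roots Rt alpha))).
- exact: fset_uniq.
- move=> b; case: matP => _ -> /imfsetP[j _ ->].
  by apply/mapP; exists j; rewrite ?mem_enum.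
by rewrite size_map size_enum_ord; case: matP => <-.
Qed.

Lemma root_mx_ge0 i j : 0 <= S i j.
Proof.
by have /pos_rootsP[_ /(_ i)] := beta_pos j; rewrite coord_beta ler0z.
Qed.

Lemma root_mx_le i j : S i j <= (c i)%:Z.
Proof.
have [_ /(_ _ (beta_root j) i)] := highP.
by rewrite coord_beta coord_theta -[(c i)%:R]/((c i)%:Z%:~R) ler_int.
Qed.

Lemma root_neq0 a : a \in Rt -> a != 0.
Proof. by apply: contraTneq => ->; exact: roots_neq0 rtP. Qed.

Lemma root_mx_col j : exists i, 0 < S i j.
Proof.
apply/existsP; apply: contraT => /existsPn S0; have := root_neq0 (beta_root j).
rewrite /beta big1 ?eqxx // => i _.
by have := S0 i; rewrite lt_def root_mx_ge0 andbT negbK => /eqP->; rewrite scale0r.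
Qed.

Lemma cartanD x y a : cartan dot (x + y) a = cartan dot x a + cartan dot y a.
Proof. by rewrite /cartan linearDl mulrDr mulrDl. Qed.

Lemma cartanZ k x a : cartan dot (k *: x) a = k * cartan dot x a.
Proof. by rewrite /cartan linearZl_LR /= mulrCA -!mulrA. Qed.

Lemma cartanN x a : cartan dot (- x) a = - cartan dot x a.
Proof. by rewrite -scaleN1r cartanZ mulN1r. Qed.

Lemma cartan_sum (k : 'I_m -> R) a :
  cartan dot (\sum_i k i *: tnth alpha i) a =
  \sum_i k i * cartan dot (tnth alpha i) a.
Proof.
rewrite (big_morph (fun x => cartan dot x a) (id1 := 0) (op1 := +%R)).
- by apply: eq_bigr => i _; rewrite cartanZ.
- by move=> x y; rewrite cartanD.
by rewrite -(scale0r 0) cartanZ mul0r.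
Qed.

Lemma dot_gt0 a : a \in Rt -> 0 < dot a a.
Proof. by move=> /root_neq0; exact: neq0_dnorm_gt0. Qed.

Lemma cartan_self a : a \in Rt -> cartan dot a a = 2.
Proof. by move=> /dot_gt0 a_gt0; rewrite /cartan mulfK // gt_eqF. Qed.

Lemma dotC x y : dot x y = dot y x.
Proof. by rewrite (hermC dot) expr0 mul1r. Qed.

Lemma cartan_ge0C a b : a \in Rt -> b \in Rt ->
  (0 <= cartan dot a b) = (0 <= cartan dot b a).
Proof.
move=> /dot_gt0 a_gt0 /dot_gt0 b_gt0.
rewrite /cartan [LHS]pmulr_lge0 ?invr_gt0 //.
by rewrite [RHS]pmulr_lge0 ?invr_gt0 // dotC.
Qed.

Lemma cartan_reflection a x : a \in Rt ->
  cartan dot (reflection dot a x) a = - cartan dot x a.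
Proof.
move=> aR; rewrite /reflection cartanD cartanN cartanZ cartan_self //; ring.
Qed.

Lemma reflectionK a : a \in Rt -> involutive (reflection dot a).
Proof.
move=> aR x; rewrite {1}/reflection cartan_reflection // scaleNr opprK.
by rewrite /reflection subrK.
Qed.

Lemma reflection_self a : a \in Rt -> reflection dot a a = - a.
Proof.
move=> aR; rewrite /reflection cartan_self // scaler_nat mulr2n.
by rewrite opprD addrA subrr sub0r.
Qed.

Lemma rootN a : a \in Rt -> - a \in Rt.
Proof.
by move=> aR; rewrite -reflection_self //; apply: (roots_reflection rtP).
Qed.

Lemma wall_of_roots j0 (e : int) (p : 'I_n -> 'I_n) :
  injective p -> p j0 = j0 ->
  (forall j, j != j0 ->
     (e%:~R * cartan dot (beta j) (beta j0) = 0 /\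
        reflection dot (beta j0) (beta j) = beta (p j)) \/
     (e%:~R * cartan dot (beta j) (beta j0) = 1 /\
        reflection dot (beta j0) (beta j) = - beta (p j))) ->
  wall S j0 e.
Proof.
move=> p_inj pj0 pP.
(* [b] is the coroot of [beta j0] in coweight coordinates, that is, its pairings with the simple
   roots. These are integers by the crystallographic condition, so [floor] merely changes their
   type. *)
pose b : 'rV[int]_m := \row_k Num.floor (cartan dot (tnth alpha k) (beta j0)).
have bS j : ((b *m S) 0 j)%:~R = cartan dot (beta j) (beta j0).
  rewrite cartan_sum mxE rmorph_sum; apply: eq_bigr => k _.
  rewrite rmorphM mxE mulrC /= floorK //.
  by apply: (roots_integral rtP);
    [exact: beta_root|exact: simple_in_roots simP k].
have colE j i : ((col j S - (b *m S) 0 j *: col j0 S) i 0)%:~R =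
    coord alpha i (reflection dot (beta j0) (beta j)).
  rewrite /reflection [in RHS]linearB [in RHS]linearZ /= !coord_beta.
  rewrite -bS -intrM -intrB.
  by congr _%:~R; rewrite !mxE.
exists b, p; split=> // [|j /pP[] [eE rE]].
- by apply: (@intr_inj R); rewrite bS cartan_self // beta_root.
- left; split; first by apply: (@intr_inj R); rewrite rmorphM /= bS eE.
  apply/colP => i; apply: (@intr_inj R).
  by rewrite colE rE coord_beta !mxE.
right; split; first by apply: (@intr_inj R); rewrite rmorphM /= bS eE.
apply/colP => i; apply: (@intr_inj R).
by rewrite colE rE linearN /= coord_beta !mxE rmorphN.
Qed.

(** The reflection changes only the [i]-th coordinate. By reducedness a positive root other than the
    simple one has another positive coordinate, so its image cannot be negative. *)
Lemma reflection_simple_pos i j : beta j != tnth alpha i ->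
  exists j', beta j' = reflection dot (tnth alpha i) (beta j).
Proof.
move=> neq; have aR := simple_in_roots simP i.
have rR := roots_reflection rtP aR (beta_root j).
have cE l : l != i -> coord alpha l (reflection dot (tnth alpha i) (beta j)) =
    (S l j)%:~R.
  move=> /negPf li; rewrite /reflection linearB linearZ /= coord_beta.
  by rewrite coord_alpha li mulr0 subr0.
have [l li Sl] : exists2 l, l != i & 0 < S l j.
  apply/exists_inP; apply: contraT => /exists_inPn S0.
  have bE : beta j = (S i j)%:~R *: tnth alpha i.
    rewrite /beta (bigD1 i) //= big1 ?addr0 // => l li.
    have := S0 l li; rewrite lt_def root_mx_ge0 andbT negbK => /eqP->.
    by rewrite scale0r.
  have := beta_root j; rewrite bE => /(roots_reduced rtP aR) [] S1.
    by move: neq; rewrite bE S1 scale1r eqxx.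
  have := root_mx_ge0 i j; rewrite -(ler0z R) S1 oppr_ge0.
  by rewrite leNgt ltr01.
apply: pos_beta => //.
have [//|le0] := simple_sign simP rR.
by have := le0 l; rewrite cE // lerz0 leNgt Sl.
Qed.

Lemma simple_index :
  exists sg : 'I_m -> 'I_n, forall i, beta (sg i) = tnth alpha i.
Proof.
apply: (@fin_all_exists _ _ (fun i j => beta j = tnth alpha i)) => i.
apply: pos_beta => [|l]; first exact: simple_in_roots simP i.
by rewrite coord_alpha ler0n.
Qed.

Lemma theta_index : exists jt, beta jt = theta.
Proof.
case: highP => thR _; apply: pos_beta => // i.
by rewrite coord_theta ler0n.
Qed.

(** The reflection permutes the positive roots other than the simple one, which it negates; [p]
    fixes that index. With [e = 0] only the first alternative of [wall] occurs. *)
Lemma simple_wall i j0 : beta j0 = tnth alpha i -> wall S j0 0.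
Proof.
move=> j0E; have aR := simple_in_roots simP i.
have [p pP] : exists p : 'I_n -> 'I_n, forall j, if j == j0 then p j = j0 else
    beta (p j) = reflection dot (tnth alpha i) (beta j).
  apply: (@fin_all_exists _ _ (fun j j' => if j == j0 then j' = j0 else
    beta j' = reflection dot (tnth alpha i) (beta j))) => j.
  have [_|neq] := eqVneq j j0; first by exists j0.
  by apply: reflection_simple_pos; rewrite -j0E (inj_eq beta_inj).
have pj0 : p j0 = j0 by have := pP j0; rewrite eqxx.
(* A positive root reflected to the simple root would be the negative of that simple root. *)
have p_neq j : j != j0 -> p j != j0.
  move=> jj0; apply/eqP => E; have := pP j; rewrite (negPf jj0) E j0E.
  move/(congr1 (reflection dot (tnth alpha i))).
  rewrite reflectionK // reflection_self //.
  move/(congr1 (coord alpha i)).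
  rewrite linearN /= coord_alpha eqxx coord_beta => E1.
  have := root_mx_ge0 i j; rewrite -(ler0z R) -E1 oppr_ge0.
  by rewrite leNgt ltr01.
apply: (wall_of_roots (p := p)) => // [j j'|j jj0]; last first.
  by left; rewrite mul0r j0E; have := pP j; rewrite (negPf jj0) => ->.
have [->|jj0] := eqVneq j j0; have [->|jj0'] := eqVneq j' j0; rewrite ?pj0 //.
- by move=> E; have := p_neq j' jj0'; rewrite -E eqxx.
- by move=> E; have := p_neq j jj0; rewrite E eqxx.
move=> E; have := pP j; have := pP j'; rewrite (negPf jj0) (negPf jj0') E => ->.
by move/(can_inj (reflectionK aR))/beta_inj.
Qed.

(** If [theta] paired negatively with a simple coroot, the simple reflection would raise a
    coordinate of [theta] above its maximum; the sign of the pairing is symmetric in the two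
    roots. *)
Lemma cartan_theta_ge0 j : 0 <= cartan dot (beta j) theta.
Proof.
case: highP => thR high; rewrite cartan_sum sumr_ge0 // => i _.
have aR := simple_in_roots simP i.
rewrite mulr_ge0 ?ler0z ?root_mx_ge0 // cartan_ge0C // leNgt; apply/negP => lt0.
have := high _ (roots_reflection rtP aR thR) i.
rewrite /reflection linearB linearZ /= coord_alpha eqxx mulr1.
by rewrite gerDl oppr_le0 leNgt lt0.
Qed.

(* [s_theta beta >= -theta] bounds [<beta, theta^vee>] by 1 if [beta != theta]. *)
Lemma cartan_theta01 j : beta j != theta ->
  cartan dot (beta j) theta = 0 \/ cartan dot (beta j) theta = 1.
Proof.
case: highP => thR high neq; have bR := beta_root j.
have := cartan_theta_ge0 j; have /intrP[k kE] := roots_integral rtP thR bR.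
rewrite kE ler0z => k_ge0.
have [k_le1|k_gt1] := leP k 1.
  have [->|->] : k = 0 \/ k = 1 by lia.
    by left.
  by right.
case/eqP: neq; apply: coord_inj => i; apply/le_anti; rewrite high //=.
have := high _ (rootN (roots_reflection rtP thR bR)) i.
rewrite /reflection kE opprB linearB linearZ /= coord_theta.
have k2 : 2 <= k%:~R :> R by rewrite -[2]/(2%:~R) ler_int.
have : 0 <= (c i)%:R :> R by rewrite ler0n.
nra.
Qed.

(** [s_theta] fixes the roots of pairing 0. On those of pairing 1, [- s_theta] is
    [beta |-> theta - beta], which is positive because [theta] dominates every root. *)
Lemma theta_wall jt : beta jt = theta -> wall S jt 1.
Proof.
move=> jtE; have [thR high] := highP.
have [p pP] : exists p : 'I_n -> 'I_n, forall j, if j == jt then p j = jt else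
    (cartan dot (beta j) theta = 0 /\ p j = j) \/
    (cartan dot (beta j) theta = 1 /\ beta (p j) = theta - beta j).
  apply: (@fin_all_exists _ _ (fun j j' => if j == jt then j' = jt else
    (cartan dot (beta j) theta = 0 /\ j' = j) \/
    (cartan dot (beta j) theta = 1 /\ beta j' = theta - beta j))) => j.
  have [_|neq] := eqVneq j jt; first by exists jt.
  have [|c0|c1] := @cartan_theta01 j; first by rewrite -jtE (inj_eq beta_inj).
    by exists j; left.
  have [|i|j' j'E] := @pos_beta (theta - beta j).
  - rewrite -opprB rootN //; have := roots_reflection rtP thR (beta_root j).
    by rewrite /reflection c1 scale1r.
  - by rewrite linearB /= subr_ge0 high ?beta_root.
  by exists j'; right.
have pjt : p jt = jt by have := pP jt; rewrite eqxx.
have p_neq j : j != jt -> p j != jt.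
  move=> jjt; have := pP j; rewrite (negPf jjt) => -[[_ ->] //|[_ pE]].
  apply/eqP => E; move: pE; rewrite E jtE => /esym/eqP.
  rewrite -subr_eq0 addrAC subrr sub0r oppr_eq0.
  by rewrite (negPf (root_neq0 (beta_root j))).
apply: (wall_of_roots (p := p)) => // [j j'|j jjt]; last first.
  have := pP j; rewrite (negPf jjt) jtE mul1r /reflection => -[[c0 ->]|[c1 ->]].
    by left; rewrite c0 scale0r subr0.
  by right; rewrite c1 scale1r opprB.
have [->|jjt] := eqVneq j jt; have [->|jjt'] := eqVneq j' jt; rewrite ?pjt //.
- by move=> E; have := p_neq j' jjt'; rewrite -E eqxx.
- by move=> E; have := p_neq j jjt; rewrite E eqxx.
(* [theta - beta l] has pairing [2 - 1 = 1], so [p] keeps the two classes apart. *)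
have mixed k l : cartan dot (beta k) theta = 0 ->
    cartan dot (beta l) theta = 1 ->
    beta k = theta - beta l -> False.
  move=> ck cl E; move: ck; rewrite E cartanD cartanN cl cartan_self //.
  by apply/eqP; rewrite -[2]/(1 + 1) addrK oner_eq0.
have := pP j; have := pP j'; rewrite (negPf jjt) (negPf jjt').
move=> [[c' p'E]|[c' p'E]] [[cj pE]|[cj pE]] E.
- by rewrite -pE E.
- by case: (mixed _ _ c' cj); rewrite -pE E p'E.
- by case: (mixed _ _ cj c'); rewrite -p'E -E pE.
by apply/beta_inj/oppr_inj/(addrI theta); rewrite -pE -p'E E.
Qed.

Lemma chi_root_system p :
  chi S p.+1 = ((\prod_i c i) * m`! * #|simplex c p|)%N.
Proof.
have [sg sgE] := simple_index; have [jt jtE] := theta_index.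
apply: (chi_simplex (sg := sg) (jt := jt)).
- exact: root_mx_ge0.
- exact: root_mx_col.
- exact: root_mx_le.
- by move=> i; apply: (@intr_inj R); rewrite -coord_beta jtE coord_theta.
- move=> i l; apply: (@intr_inj R).
  by rewrite -coord_beta sgE coord_alpha; case: eqP.
- by move=> i; apply: simple_wall (sgE i).
exact: theta_wall.
Qed.

End RootWalls.

Theorem theorem3p1 (R : realType) (V : vectType R) (dot : {dot V for idfun})
    (Rt : {fset V}) (m : nat) (alpha : m.-tuple V)
    (theta : V) (c : 'I_m -> nat) (h : nat) (n : nat) (S : 'M[int]_(m, n)) :
  root_system dot Rt ->
  irreducible_roots dot Rt ->
  simple_roots Rt alpha ->
  highest_root Rt alpha theta ->
  theta = \sum_(i < m) (c i)%:R *: tnth alpha i ->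
  h = (1 + \sum_(i < m) c i)%N ->
  root_matrix Rt alpha S ->
  chi_series S =1
    fps_div
      (fps_of_poly (((\prod_(i < m) c i) * m`!)%:R *: 'X^h))
      (fps_of_poly ((1 - 'X) * \prod_(i < m) (1 - 'X^(c i)))).
Proof.
move=> rtP _ simP highP thetaE -> matP k.
have c_gt0 i : (0 < c i)%N.
  have [_ /(_ _ (simple_in_roots simP i) i)] := highP.
  by rewrite (coord_alpha simP) (coord_theta simP thetaE) eqxx ler_nat.
(* The rank is positive because a root, here the highest one, has a nonzero coordinate. *)
have sum_c_gt0 : (0 < \sum_i c i)%N.
  have [jt jtE] := theta_index simP highP thetaE matP.
  have [i _] := root_mx_col rtP simP matP jt.
  by rewrite (bigD1 i) //= addn_gt0 c_gt0.
rewrite add1n fps_div_denom // /chi_series; case: k => // p.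
by rewrite (chi_root_system rtP simP highP thetaE matP) natrM.
Qed.
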